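(* If $\phi=(\phi_{t,s})_{0\le s\le t\le T}$ is a stable almost flow and $\epsilon=(\epsilon_{t,s})_{0\le s\le t\le T}$ is a Lipschitz perturbation, then $\psi:=\phi+\epsilon$ is also a stable almost flow.
   Context: Setting. $(V,|\cdot|)$ is a Banach space and $T>0$ a time horizon. For $f:V\to V$, $\|f\|_\infty=\sup_a|f(a)|$ and $\|f\|_{\mathrm{Lip}}=\sup_{a\ne b}|f(a)-f(b)|/|a-b|$. A control $\omega$ is a family of numbers $\omega_{s,t}\ge0$, $0\le s\le t\le T$, which is super-additive ($\omega_{r,s}+\omega_{s,t}\le\omega_{r,t}$ for $r\le s\le t$), continuous near the diagonal, with $\omega_{s,s}=0$. A remainder $\varpi:[0,\omega_{0,T}]\to\mathbb R_+$ is a continuous increasing function such that for some $0<\varkappa<1$, $2\varpi(\tau/2)\le\varkappa\varpi(\tau)$ for $\tau>0$. $\delta:\mathbb R_+\to\mathbb R_+$, $T'\mapsto\delta_{T'}$, denotes a non-decreasing function with $\lim_{T'\to0}\delta_{T'}=0$; it may differ from one almost flow to another. 4-points control. A function $f:V\to V$ satisfies a 4-points control if there are a non-decreasing continuous function $\widehat f:\mathbb R_+\to\mathbb R_+$ and a constant $f^\dagger\ge0$ such that for all $a,b,c,d\in V$, $$|f(a)-f(b)-f(c)+f(d)|\le\widehat f(|a-b|\vee|c-d|)\,(|a-c|\vee|b-d|)+f^\dagger|a-b-c+d|.$$ Stable almost flow. A family of continuous maps $\phi_{t,s}:V\to V$, $0\le s\le t\le T$, is a stable almost flow if, with $\phi_{t,s,r}:=\phi_{t,s}\circ\phi_{s,r}-\phi_{t,r}$,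 there are such a $\delta$ and constants $M,C\ge0$ such that for every $T'\in(0,T]$ and all $0\le r\le s\le t\le T'$: (a) $\phi_{t,t}=\mathrm{id}$; $\|\phi_{t,s}-\mathrm{id}\|_\infty\le\delta_{T'}$; $\|\phi_{t,s}\|_{\mathrm{Lip}}\le1+\delta_{T'}$; $\|\phi_{t,s,r}\|_\infty\le M\varpi(\omega_{r,t})$; (b) each $\phi_{t,s}$ satisfies a 4-points control with some $\widehat\phi_{t,s}$ and $\phi^\dagger_{t,s}\le1+\delta_{T'}$, and it is $\varpi$-compatible: $\widehat\phi_{t,s}\le\widehat\phi_{v,u}$ whenever $[s,t]\subset[u,v]$, and $\widehat\phi_{t,s}(\alpha\varpi(\omega_{s,t}))\le\phi^{\circledast}(\alpha)\varpi(\omega_{s,t})$ for all $\alpha\ge0$, where $\phi^\circledast:\mathbb R_+\to\mathbb R_+$ is a function not depending on $(s,t)$; (c) $\|\phi_{t,s,r}\|_{\mathrm{Lip}}\le C\varpi(\omega_{r,t})$. Lipschitz perturbation. A family of continuous maps $\epsilon_{t,s}:V\to V$, $0\le s\le t\le T$, for which there is a constant $C\ge0$ with $\epsilon_{t,t}=0$, $\|\epsilon_{t,s}\|_\infty\le C\varpi(\omega_{s,t})$ and $\|\epsilon_{t,s}\|_{\mathrm{Lip}}\le C\varpi(\omega_{s,t})$ for all $0\le s\le t\le T$.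
   Formalization: When the control vanishes identically (ω_{0,T}=0), the remainder is additionally required to satisfy ϖ(0)=0; without this the claim fails (φ=id, ε_{t,s} a nonzero constant for s<t). *)

(* Defs.v *)
(* Conventions: a function on R_+ (or on [0, L]) is a total function R -> R
   constrained only on that domain, and a family indexed by 0 <= s <= t <= T is
   a total family constrained only there.  Controls are indexed as omega s t,
   flows and perturbations as phi t s (final time first). *)
From HB Require Import structures.
From mathcomp Require Import all_boot all_order all_algebra.
From mathcomp Require Import all_classical all_reals all_analysis.
Set Implicit Arguments.
Unset Strict Implicit.
Unset Printing Implicit Defensive.
Import Order.TTheory GRing.Theory Num.Theory.
Import numFieldNormedType.Exports.
Local Open Scope classical_set_scope.
Local Open Scope ring_scope.

Section Defs.
Context {R : realType} {V : completeNormedModType R}.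

Definition sup_norm (f : V -> V) : \bar R :=
  ereal_sup [set `|f a|%:E | a in [set: V]].

(* If V is trivial the supremum is over the empty set and equals -oo rather
   than 0; only upper bounds by nonnegative reals are ever required of it. *)
Definition lip_norm (f : V -> V) : \bar R :=
  ereal_sup [set (`|f p.1 - f p.2| / `|p.1 - p.2|)%:E
            | p in [set p : V * V | p.1 != p.2]].

Definition triangle (T : R) : set (R * R) :=
  [set p | 0 <= p.1 /\ p.1 <= p.2 <= T].

(* Continuity is required only at the points of the diagonal, relatively to
   the triangle, which is the weakest sense of "continuous near the diagonal". *)
Definition is_control (T : R) (omega : R -> R -> R) : Prop :=
  [/\ forall s t, 0 <= s -> s <= t <= T -> 0 <= omega s t,
      forall r s t, 0 <= r -> r <= s -> s <= t <= T ->
        omega r s + omega s t <= omega r t,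
      forall s, 0 <= s <= T ->
        omega p.1 p.2 @[p --> within (triangle T) (nbhs (s, s))] --> omega s s
    & forall s, 0 <= s <= T -> omega s s = 0].

(* L stands for omega 0 T.  When 0 < L, the inequality and continuity force
   varpi 0 = 0.  When L = 0 the inequality is void, and varpi 0 = 0 is required
   explicitly: otherwise terms of size varpi 0 need not vanish as T' -> 0. *)
Definition is_remainder (L : R) (varpi : R -> R) : Prop :=
  [/\ {in `[0, L], forall x, 0 <= varpi x},
      {within `[0, L], continuous varpi},
      {in `[0, L] &, {homo varpi : x y / x < y}},
      exists kappa : R, 0 < kappa < 1 /\
        forall tau, 0 < tau <= L -> 2 * varpi (tau / 2) <= kappa * varpi tau
    & L = 0 -> varpi 0 = 0].

Definition is_modulus (delta : R -> R) : Prop :=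
  [/\ forall x, 0 <= x -> 0 <= delta x,
      forall x y, 0 <= x -> x <= y -> delta x <= delta y
    & delta x @[x --> 0^'+] --> 0].

Definition four_points_control (f : V -> V) (fhat : R -> R) (fdag : R) : Prop :=
  [/\ forall x, 0 <= x -> 0 <= fhat x,
      forall x y, 0 <= x -> x <= y -> fhat x <= fhat y,
      {within `[0, +oo[, continuous fhat},
      0 <= fdag
    & forall a b c d : V,
        `|f a - f b - f c + f d| <=
          fhat (Num.max `|a - b| `|c - d|) * Num.max `|a - c| `|b - d|
          + fdag * `|a - b - c + d|].

Definition varpi_compatible (T : R) (omega : R -> R -> R) (varpi : R -> R)
    (phihat : R -> R -> R -> R) (phistar : R -> R) : Prop :=
  [/\ forall alpha, 0 <= alpha -> 0 <= phistar alpha,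
      forall u s t v x, 0 <= u -> u <= s -> s <= t -> t <= v -> v <= T ->
        0 <= x -> phihat t s x <= phihat v u x
    & forall s t alpha, 0 <= s -> s <= t <= T -> 0 <= alpha ->
        phihat t s (alpha * varpi (omega s t)) <=
          phistar alpha * varpi (omega s t)].

Definition flow_defect (phi : R -> R -> V -> V) (t s r : R) : V -> V :=
  fun a => phi t s (phi s r a) - phi t r a.

Definition stable_almost_flow (T : R) (omega : R -> R -> R) (varpi : R -> R)
    (phi : R -> R -> V -> V) : Prop :=
  (forall s t, 0 <= s -> s <= t <= T -> continuous (phi t s)) /\
  exists (delta : R -> R) (M C : R) (phihat : R -> R -> R -> R)
         (phidag : R -> R -> R) (phistar : R -> R),
  [/\ is_modulus delta, 0 <= M, 0 <= C,
      varpi_compatible T omega varpi phihat phistar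
    & forall T', 0 < T' <= T ->
      forall r s t, 0 <= r -> r <= s -> s <= t <= T' ->
      [/\ [/\ forall a, phi t t a = a,
              (sup_norm (fun a => (phi t s a - a)%R) <= (delta T')%:E)%E,
              (lip_norm (phi t s) <= (1 + delta T')%:E)%E
            & (sup_norm (flow_defect phi t s r) <=
                (M * varpi (omega r t))%:E)%E],
          four_points_control (phi t s) (phihat t s) (phidag t s),
          phidag t s <= 1 + delta T'
        & (lip_norm (flow_defect phi t s r) <= (C * varpi (omega r t))%:E)%E]].

Definition lipschitz_perturbation (T : R) (omega : R -> R -> R)
    (varpi : R -> R) (eps : R -> R -> V -> V) : Prop :=
  (forall s t, 0 <= s -> s <= t <= T -> continuous (eps t s)) /\
  exists C : R, 0 <= C /\
    forall s t, 0 <= s -> s <= t <= T ->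
    [/\ forall a, eps t t a = 0,
        (sup_norm (eps t s) <= (C * varpi (omega s t))%:E)%E
      & (lip_norm (eps t s) <= (C * varpi (omega s t))%:E)%E].

End Defs.

(* Main.v *)
Require Import Defs.
From HB Require Import structures.
From mathcomp Require Import all_boot all_order all_algebra.
From mathcomp Require Import all_classical all_reals all_analysis.
From mathcomp Require Import lra.
Import Order.TTheory GRing.Theory Num.Theory.
Import numFieldNormedType.Exports.
Local Open Scope ring_scope.

(** Write [w s t] for [varpi (omega s t)] and [K] for the constant of the
perturbation.  Each [eps t s] has sup norm and Lipschitz constant at most
[K * w s t], and [w] does not decrease when the time interval is enlarged; so
each requirement on [psi := phi + eps] differs from the one on [phi] by terms of
order [w].

The distance to the identity and the Lipschitz constant grow by at most
[K * w s t <= K * w 0 T'] for [t <= T'], so [K * w 0 T'] is added to the modulus.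
The sum is still a modulus because [omega 0 T'] tends to [0], by continuity of
the control at the origin, and [varpi] vanishes at [0], which follows from the
halving inequality when [0 < omega 0 T] ([remainder_control_modulus], [remainder0]).

The map [eps t s] is Lipschitz, hence has a 4-points control whose hat
function is the constant [2 * (K * w s t)] and whose dagger constant is zero.
Therefore [psi] keeps the dagger constants of [phi], and only [2 * K] is added
to the function [phistar] ([four_points_lipschitz], [four_points_controlD]).

The defect of [psi] is that of [phi], plus an increment of [phi t s] between two
points at distance [|eps s r a|], plus values of [eps] ([flow_defectD]).  Its
sup norm only needs [phi t s] to be Lipschitz.  Its Lipschitz constant is where
stability enters: the difference of two increments of [phi t s] is an
alternating sum over four points, and the 4-points control bounds it by
[phihat t s (K * w r t)] times a Lipschitz constant, plus the dagger constant
times [K * w r t].  By compatibility,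
[phihat t s (K * w r t) <= phihat t r (K * w r t) <= phistar K * w r t], so the
whole is again of order [w r t]. *)

(** * Norms and 4-points controls *)

Lemma sup_norm_leP {R : realType} {V : completeNormedModType R} (f : V -> V)
    (c : R) :
  (sup_norm f <= c%:E)%E <-> forall a, `|f a| <= c.
Proof.
split=> [fc a|fc].
  rewrite -lee_fin; apply: le_trans fc.
  by apply: ereal_sup_ubound; exists a.
by apply: ge_ereal_sup => _ [a _ <-]; rewrite lee_fin.
Qed.

(** The supremum only ranges over pairs of distinct points; on the diagonal both
sides of the increment inequality vanish, so the equivalence holds for [c] of
any sign. *)
Lemma lip_norm_leP {R : realType} {V : completeNormedModType R} (f : V -> V)
    (c : R) :
  (lip_norm f <= c%:E)%E <-> forall a b, `|f a - f b| <= c * `|a - b|.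
Proof.
split=> [fc a b|fc].
  have [->|ab] := eqVneq a b; first by rewrite !subrr normr0 mulr0.
  rewrite -ler_pdivrMr ?normr_gt0 ?subr_eq0// -lee_fin.
  by apply: le_trans fc; apply: ereal_sup_ubound; exists (a, b).
apply: ge_ereal_sup => _ [[a b] /= ab <-].
by rewrite lee_fin ler_pdivrMr ?normr_gt0 ?subr_eq0.
Qed.

(** Pairing [a] with [c] and [b] with [d] splits the alternating sum into two
increments of [f], each at most [k * Num.max `|a - c| `|b - d|]. *)
Lemma four_points_lipschitz {R : realType} {V : completeNormedModType R}
    (f : V -> V) (k : R) : 0 <= k ->
  (forall a b, `|f a - f b| <= k * `|a - b|) ->
  four_points_control f (fun=> 2 * k) 0.
Proof.
move=> k0 fk; split=> //; first by move=> x _; exact: mulr_ge0.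
  by apply: continuous_subspaceT => x; exact: cvg_cst.
move=> a b c d; rewrite mul0r addr0.
have -> : f a - f b - f c + f d = (f a - f c) - (f b - f d).
  by rewrite (addrAC (f a)) opprB [in RHS](addrC (f d)) addrA.
apply: le_trans (ler_normB _ _) _.
rewrite -mulrA mulr_natl mulr2n; apply: lerD.
  by apply: le_trans (fk _ _) _; rewrite ler_wpM2l// le_max lexx.
by apply: le_trans (fk _ _) _; rewrite ler_wpM2l// le_max lexx orbT.
Qed.

Lemma four_points_controlD {R : realType} {V : completeNormedModType R}
    (f g : V -> V) (fhat ghat : R -> R) (fdag gdag : R) :
  four_points_control f fhat fdag -> four_points_control g ghat gdag ->
  four_points_control (fun a => f a + g a) (fun x => fhat x + ghat x)
    (fdag + gdag).
Proof.
case=> f0 fmono fcont fdag0 f4 [g0 gmono gcont gdag0 g4]; split.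
- by move=> x x0; rewrite addr_ge0 ?f0 ?g0.
- by move=> x y x0 xy; rewrite lerD ?fmono ?gmono.
- by move=> x; apply: cvgD; [exact: fcont|exact: gcont].
- exact: addr_ge0.
move=> a b c d.
have -> : f a + g a - (f b + g b) - (f c + g c) + (f d + g d) =
    (f a - f b - f c + f d) + (g a - g b - g c + g d).
  by rewrite !opprD (addrACA (f a)) (addrACA (f a - f b))
    (addrACA (f a - f b - f c)).
apply: le_trans (ler_normD _ _) _.
by rewrite !mulrDl addrACA lerD.
Qed.

(** * Controls, remainders and moduli *)

(** Super-additivity over [u <= s <= t <= v], discarding the nonnegative outer
pieces. *)
Lemma control_le {R : realType} (T : R) (omega : R -> R -> R) (u s t v : R) :
  is_control T omega -> 0 <= u -> u <= s -> s <= t -> t <= v -> v <= T ->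
  omega s t <= omega u v.
Proof.
move=> [om0 omD _ _] u0 us st tv vT.
have usv := omD u s v u0 us; have stv := omD s t v.
have us0 := om0 u s u0; have tv0 := om0 t v.
lra.
Qed.

Lemma control_bounds {R : realType} (T : R) (omega : R -> R -> R) (s t : R) :
  is_control T omega -> 0 <= s -> s <= t <= T -> omega s t \in `[0, omega 0 T].
Proof.
move=> om s0 stT; case: (om) => om0 _ _ _; case/andP: (stT) => st tT.
by rewrite in_itv/= om0//= (control_le T).
Qed.

Lemma remainder_le {R : realType} (L : R) (varpi : R -> R) :
  is_remainder L varpi -> {in `[0, L] &, {homo varpi : x y / x <= y}}.
Proof.
case=> _ _ vmono _ _ x y xL yL; rewrite le_eqVlt => /predU1P[->//|xy].
exact/ltW/vmono.
Qed.

(** Suppose [0 < L].  Monotonicity bounds [varpi 0] by [varpi (x / 2)], so the halving inequality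
gives [2 * varpi 0 <= kappa * varpi x]; letting [x] tend to [0] leaves
[2 * varpi 0 <= kappa * varpi 0] with [kappa < 1]. *)
Lemma remainder0 {R : realType} (L : R) (varpi : R -> R) :
  0 <= L -> is_remainder L varpi -> varpi 0 = 0.
Proof.
move=> L0 rem; have vle := remainder_le L varpi rem.
case: rem => v0 vcont _ [kappa [/andP[k0 k1] vkappa]] vL0.
move: (L0); rewrite le_eqVlt => /predU1P[/esym/vL0//|Lgt0].
have v00 : 0 <= varpi 0 by apply: v0; rewrite in_itv/= lexx.
have [_ vr _] := (continuous_within_itvP varpi Lgt0).1 vcont.
have kvr : (kappa * varpi x @[x --> 0^'+] --> kappa * varpi 0)%classic.
  by apply: cvgM => //; exact: cvg_cst.
have : 2 * varpi 0 <= kappa * varpi 0.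
  apply: (cvgr_to_ge kvr); near=> x.
  have x0 : 0 < x by near: x; exact: nbhs_right_gt.
  have xL : x <= L by near: x; exact: nbhs_right_le.
  apply: le_trans (vkappa x _); last by rewrite x0.
  by rewrite ler_wpM2l// vle ?in_itv/= ?lexx//; lra.
nra.
Unshelve. all: by end_near. Qed.

Lemma is_modulusD {R : realType} (d1 d2 : R -> R) :
  is_modulus d1 -> is_modulus d2 -> is_modulus (fun x => d1 x + d2 x).
Proof.
case=> d1ge d1le d1cvg [d2ge d2le d2cvg]; split.
- by move=> x x0; rewrite addr_ge0 ?d1ge ?d2ge.
- by move=> x y x0 xy; rewrite lerD ?d1le ?d2le.
- by have := cvgD d1cvg d2cvg; rewrite addr0; exact.
Qed.

Lemma is_modulusZ {R : realType} (k : R) (d : R -> R) :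
  0 <= k -> is_modulus d -> is_modulus (fun x => k * d x).
Proof.
move=> k0 [dge dle dcvg]; split.
- by move=> x x0; rewrite mulr_ge0 ?dge.
- by move=> x y x0 xy; rewrite ler_wpM2l ?dle.
- by have := cvgMl_tmp (a := k) dcvg; rewrite mulr0; exact.
Qed.

(** A modulus must be non-decreasing on the whole half-line while [omega 0 x] is
only controlled for [x <= T], hence the truncation [Num.min x T]. *)
Lemma remainder_control_modulus {R : realType} (T : R) (omega : R -> R -> R)
    (varpi : R -> R) :
  0 < T -> is_control T omega -> is_remainder (omega 0 T) varpi ->
  is_modulus (fun x => varpi (omega 0 (Num.min x T))).
Proof.
move=> T0 om rem.
have minT x : 0 <= x -> 0 <= Num.min x T <= T.
  by move=> x0; rewrite le_min x0 ltW//= ge_min lexx orbT.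
have bnd x : 0 <= x -> omega 0 (Num.min x T) \in `[0, omega 0 T].
  by move=> x0; exact: (control_bounds _ _ _ _ om (lexx 0) (minT x x0)).
have L0 : 0 <= omega 0 T by case: om => + _ _ _; apply; rewrite ?lexx ?ltW.
split.
- by move=> x /bnd; case: rem => + _ _ _ _; exact.
- move=> x y x0 xy; have y0 := le_trans x0 xy.
  apply: (remainder_le _ _ rem); rewrite ?bnd//.
  case/andP: (minT _ x0) => mx0 _; case/andP: (minT _ y0) => _ myT.
  apply: (control_le T _ _ _ _ _ om) => //.
  by rewrite le_min !ge_min xy lexx orbT.
have omcvg : (omega 0 (Num.min x T) @[x --> 0^'+] --> 0)%classic.
  case: om => _ _ omcont om00.
  have pcvg : ((0 : R, Num.min x T) @[x --> 0^'+] --> (0 : R, 0 : R))%classic.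
    apply: (@cvg_pair _ _ _ _ (nbhs (0 : R)) (nbhs (0 : R))).
      exact: cvg_cst.
    apply: (@cvg_trans _ (id x @[x --> 0^'+])%classic).
      apply: near_eq_cvg; near=> x; rewrite min_l//.
      by near: x; exact: nbhs_right_le.
    by apply: cvg_at_right_filter; exact: cvg_id.
  have := omcont 0; rewrite om00 lexx ltW// => /(_ isT) omcvg.
  move=> P /omcvg/= nP.
  change (\forall x \near 0^'+, P (omega 0 (Num.min x T)))%classic; near=> x.
  have x0 : 0 < x by near: x; exact: nbhs_right_gt.
  have : triangle T (0 : R, Num.min x T) by split => //; exact/minT/ltW.
  by near: x; exact: (pcvg _ nP).
have [_ vcont _ _ _] := rem.
have /subspace_continuousP/(_ 0) := vcont.
rewrite /= in_itv/= lexx L0 => /(_ isT) vcvg.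
rewrite -[X in (_ --> X)%classic](remainder0 _ _ L0 rem) => P /vcvg/= nP.
change (\forall x \near 0^'+, P (varpi (omega 0 (Num.min x T))))%classic.
near=> x; have x0 : 0 < x by near: x; exact: nbhs_right_gt.
have : omega 0 (Num.min x T) \in `[0, omega 0 T] by exact/bnd/ltW.
by near: x; exact: (omcvg _ nP).
Unshelve. all: by end_near. Qed.

(** * The defect of a perturbed family *)

Section perturbed_defect.
Context {R : realType} {V : completeNormedModType R}.
Context (phi eps : R -> R -> V -> V) (t s r : R).
Local Notation psi := (fun t s a => phi t s a + eps t s a).

(** The intermediate value [phi t s (phi s r a)] is inserted so that the first
difference is an increment of the single map [phi t s]. *)
Lemma flow_defectD a :
  flow_defect psi t s r a =
    (phi t s (psi s r a) - phi t s (phi s r a)) + flow_defect phi t s r a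
    + (eps t s (psi s r a) - eps t r a).
Proof.
by rewrite /flow_defect [X in _ = X + _]addrA subrK opprD addrACA.
Qed.

Lemma flow_defectD_bound (l e m : R) : 0 <= l ->
  (forall a b, `|phi t s a - phi t s b| <= l * `|a - b|) ->
  (forall a, `|eps s r a| <= e) -> (forall a, `|eps t s a| <= e) ->
  (forall a, `|eps t r a| <= e) ->
  (forall a, `|flow_defect phi t s r a| <= m) ->
  forall a, `|flow_defect psi t s r a| <= l * e + m + (e + e).
Proof.
move=> l0 lphi esr ets etr mphi a; rewrite flow_defectD.
apply: le_trans (ler_normD _ _) _; apply: lerD.
  apply: le_trans (ler_normD _ _) _; apply: lerD => //.
  apply: le_trans (lphi _ _) _; rewrite ler_wpM2l//.
  by rewrite addrC addKr.
by apply: le_trans (ler_normB _ _) _; exact: lerD.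
Qed.

(** The increment [phi t s (psi s r x) - phi t s (phi s r x)], taken at [a] and
at [b], is not controlled by the Lipschitz constant of [phi t s] alone, which
would lose the factor [e].  The 4-points control applied to [psi s r a],
[phi s r a], [psi s r b], [phi s r b] retains it: the horizontal gaps are values
of [eps s r], the vertical ones are at most [(l + e) * `|a - b|], and the
alternating sum of the points is an increment of [eps s r]. *)
Lemma flow_defectD_lipschitz (fhat : R -> R) (fdag l e m : R) :
  0 <= e ->
  four_points_control (phi t s) fhat fdag ->
  (forall a, `|eps s r a| <= e) ->
  (forall a b, `|phi s r a - phi s r b| <= l * `|a - b|) ->
  (forall a b, `|eps s r a - eps s r b| <= e * `|a - b|) ->
  (forall a b, `|eps t s a - eps t s b| <= e * `|a - b|) ->
  (forall a b, `|eps t r a - eps t r b| <= e * `|a - b|) ->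
  (forall a b, `|flow_defect phi t s r a - flow_defect phi t s r b|
     <= m * `|a - b|) ->
  forall a b, `|flow_defect psi t s r a - flow_defect psi t s r b| <=
    (fhat e * (l + e) + fdag * e + m + (e * (l + e) + e)) * `|a - b|.
Proof.
move=> e0 [fhat0 fhatle _ fdag0 f4] esr lphi lesr lets letr mphi a b.
have psiB x : psi s r x - phi s r x = eps s r x by rewrite addrC addKr.
have lpsi : `|psi s r a - psi s r b| <= (l + e) * `|a - b|.
  rewrite opprD addrACA mulrDl.
  by apply: le_trans (ler_normD _ _) _; exact: lerD.
rewrite !flow_defectD opprD addrACA [_ * `|a - b|]mulrDl.
apply: le_trans (ler_normD _ _) _; apply: lerD; last first.
  rewrite opprD addrACA -opprD mulrDl.
  apply: le_trans (ler_normB _ _) _; apply: lerD => //.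
  by apply: le_trans (lets _ _) _; rewrite -mulrA ler_wpM2l.
rewrite opprD addrACA mulrDl.
apply: le_trans (ler_normD _ _) _; apply: lerD => //.
rewrite opprB addrA addrAC.
apply: le_trans (f4 _ _ _ _) _; rewrite !psiB mulrDl.
apply: lerD.
  rewrite -mulrA ler_pM//.
  - by apply: fhat0; rewrite le_max normr_ge0.
  - by apply: fhatle; rewrite ?le_max ?normr_ge0// ge_max !esr.
  - rewrite ge_max lpsi/=; apply: le_trans (lphi _ _) _.
    by rewrite ler_wpM2r ?normr_ge0// lerDl.
by rewrite -mulrA ler_wpM2l// -addrA (addrC (- _)) -opprB psiB.
Qed.

End perturbed_defect.

Theorem proposition6 (R : realType) (V : completeNormedModType R) (T : R)
    (omega : R -> R -> R) (varpi : R -> R) (phi eps : R -> R -> V -> V)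
    (T_gt0 : 0 < T)
    (omega_control : is_control T omega)
    (varpi_remainder : is_remainder (omega 0 T) varpi)
    (phi_flow : stable_almost_flow T omega varpi phi)
    (eps_pert : lipschitz_perturbation T omega varpi eps) :
  stable_almost_flow T omega varpi (fun t s a => phi t s a + eps t s a).
Proof.
case: phi_flow => phi_cont [delta [M [C [phihat [phidag [phistar]]]]]].
case=> delta_mod M0 C0 [star0 hatle hatstar] phiP.
case: eps_pert => eps_cont [K [K0 epsP]].
have omT s t : 0 <= s -> s <= t <= T -> omega s t \in `[0, omega 0 T].
  exact: control_bounds.
pose w s t := varpi (omega s t).
have w0 s t : 0 <= s -> s <= t <= T -> 0 <= w s t.
  by move=> s0 stT; case: varpi_remainder => + _ _ _ _; apply; exact: omT.
have wle u s t v : 0 <= u -> u <= s -> s <= t -> t <= v -> v <= T ->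
    w s t <= w u v.
  move=> u0 us st tv vT; apply: (remainder_le _ _ varpi_remainder).
  - by apply: omT; lra.
  - by apply: omT; lra.
  - exact: (control_le T).
have [delta0 _ _] := delta_mod.
have D0 : 0 <= delta T by rewrite delta0 ?ltW.
have W0 : 0 <= w 0 T by apply: w0; lra.
split=> [s t s0 stT a|].
  by apply: cvgD; [exact: phi_cont|exact: eps_cont].
exists (fun x => delta x + K * w 0 (Num.min x T)).
exists ((1 + delta T) * K + M + (K + K)).
(* A Lipschitz constant common to all the maps of the perturbed family. *)
pose Lpsi := 1 + delta T + K * w 0 T.
exists (phistar K * Lpsi + (1 + delta T) * K + C + (K * Lpsi + K)).
exists (fun t s x => phihat t s x + 2 * (K * w s t)), phidag.
exists (fun alpha => phistar alpha + 2 * K).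
have Lpsi0 : 0 <= Lpsi by rewrite !addr_ge0// mulr_ge0.
split.
- apply: is_modulusD => //; apply: is_modulusZ => //.
  exact: (remainder_control_modulus T omega varpi).
- by rewrite !addr_ge0// mulr_ge0// addr_ge0.
- by rewrite !addr_ge0// ?mulr_ge0 ?star0// addr_ge0.
- split.
  + by move=> alpha alpha0; rewrite addr_ge0 ?star0 ?mulr_ge0.
  + move=> u s t v x u0 us st tv vT x0.
    by rewrite lerD ?hatle// ler_wpM2l// ler_wpM2l// wle.
  + move=> s t alpha s0 stT alpha0.
    by rewrite [leRHS]mulrDl -[2 * K * _]mulrA lerD2r hatstar.
move=> T' /andP[T'0 T'T] r s t r0 rs /andP[st tT'].
have tT : t <= T := le_trans tT' T'T.
have s0 : 0 <= s := le_trans r0 rs.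
have T'T' : 0 < T' <= T by lra.
have stT' : s <= t <= T' by lra.
have [[phi_id /sup_norm_leP phi_near /lip_norm_leP phi_lip _] phi4 dagle _] :=
  phiP T' T'T' r s t r0 rs stT'.
(* The bounds on the defect must have constants that do not depend on [T'], so
   the bounds on [phi] that enter them are taken at the horizon [T]. *)
have TT : 0 < T <= T by lra.
have rsT : r <= s <= T by lra.
have rtT : r <= t <= T by lra.
have stT : s <= t <= T by lra.
have [[_ _ /lip_norm_leP sr_lip _] _ _ _] := phiP T TT r r s r0 (lexx r) rsT.
have [[_ _ /lip_norm_leP ts_lip /sup_norm_leP def_sup] _ dagT
  /lip_norm_leP def_lip] := phiP T TT r s t r0 rs stT.
have [_ /sup_norm_leP sr_sup /lip_norm_leP esr_lip] := epsP r s r0 rsT.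
have [eps_id /sup_norm_leP ts_sup /lip_norm_leP ets_lip] := epsP s t s0 stT.
have [_ /sup_norm_leP tr_sup /lip_norm_leP etr_lip] := epsP r t r0 rtT.
have wrt0 : 0 <= w r t by exact: w0.
have sr_le : K * w r s <= K * w r t by rewrite ler_wpM2l// wle//; lra.
have ts_le : K * w s t <= K * w r t by rewrite ler_wpM2l// wle//; lra.
have near_le : K * w s t <= K * w 0 (Num.min T' T).
  rewrite min_l// ler_wpM2l// wle//; lra.
have W_le : K * w r t <= K * w 0 T by rewrite ler_wpM2l// wle//; lra.
split.
- split.
  + by move=> a; rewrite phi_id eps_id addr0.
  + apply/sup_norm_leP => a; rewrite addrAC.
    apply: le_trans (ler_normD _ _) _; rewrite lerD//.
    exact: le_trans (ts_sup a) near_le.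
  + apply/lip_norm_leP => a b; rewrite opprD addrACA [1 + _]addrA mulrDl.
    apply: le_trans (ler_normD _ _) _; rewrite lerD//.
    by apply: le_trans (ets_lip _ _) _; rewrite ler_wpM2r.
  + apply/sup_norm_leP => a.
    apply: (@le_trans _ _ ((1 + delta T) * (K * w r t) + M * w r t +
      (K * w r t + K * w r t))); last by rewrite -/(w r t); lra.
    apply: flow_defectD_bound => //.
    * by rewrite addr_ge0.
    * by move=> b; exact: le_trans (sr_sup b) sr_le.
    * by move=> b; exact: le_trans (ts_sup b) ts_le.
- rewrite -[phidag t s]addr0; apply: four_points_controlD => //.
  by apply: four_points_lipschitz => //; rewrite mulr_ge0 ?w0.
- apply: le_trans dagle _; rewrite addrA lerDl.
  by rewrite (le_trans _ near_le) ?mulr_ge0 ?w0.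
apply/lip_norm_leP => a b.
apply: le_trans (flow_defectD_lipschitz phi eps t s r (phihat t s) (phidag t s)
  (1 + delta T) (K * w r t) (C * w r t) _ _ _ _ _ _ _ _ a b) _ => //.
- by rewrite mulr_ge0.
- by move=> x; exact: le_trans (sr_sup x) sr_le.
- by move=> x y; apply: le_trans (esr_lip _ _) _; rewrite ler_wpM2r.
- by move=> x y; apply: le_trans (ets_lip _ _) _; rewrite ler_wpM2r.
rewrite ler_wpM2r// -/(w r t).
have Kw0 : 0 <= K * w r t by rewrite mulr_ge0.
(* Compatibility bounds [phihat] at [K * w r t] over the interval [r, t], so
   [s, t] is first enlarged to it. *)
have phihat_le : phihat t s (K * w r t) <= phistar K * w r t.
  apply: le_trans (hatstar r t K r0 rtT K0).
  by apply: hatle => //; lra.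
have Lpsi_le : 1 + delta T + K * w r t <= Lpsi by rewrite lerD2l.
rewrite ![in leRHS]mulrDl -!addrA.
have hat_term : phihat t s (K * w r t) * (1 + delta T + K * w r t) <=
    phistar K * w r t * Lpsi.
  case: phi4 => hat0 _ _ _ _.
  by apply: ler_pM => //; rewrite ?hat0// !addr_ge0.
have dag_term : phidag t s * (K * w r t) <= (1 + delta T) * (K * w r t).
  by rewrite ler_wpM2r.
have eps_term : K * w r t * (1 + delta T + K * w r t) <= K * w r t * Lpsi.
  by rewrite ler_wpM2l.
lra.
Qed.
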